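(* Let $G$ be a sharply $2$-transitive permutation group of characteristic $0$ whose point stabilizers are virtually abelian (i.e. have an abelian subgroup of finite index). Then $G$ is split.
   Context: A permutation group $G$ on a set $X$ with at least two points is sharply $2$-transitive if for all $x\ne y$ and $x'\neq y'$ in $X$ there is exactly one $g\in G$ with $g(x)=x'$ and $g(y)=y'$. Such a group contains involutions (elements of order $2$), and all involutions are conjugate. $G$ has (permutation) characteristic $2$ if involutions have no fixed points. If involutions have fixed points, then either all products of two distinct involutions have the same odd prime order $p$, and $G$ has characteristic $p$, or all products of two distinct involutions have infinite order, and $G$ has characteristic $0$. The group $G$ with point stabilizer $B$ is split if there is a normal subgroup $N$ of $G$ such that $G=N\rtimes B$. No assumption on Morley rank is made. *)

(* Defs.v *)
From mathcomp Require Import all_boot.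
From mathcomp Require Import boolp classical_sets functions cardinality.

Set Implicit Arguments.
Unset Strict Implicit.
Unset Printing Implicit Defensive.

Local Open Scope classical_set_scope.
Local Open Scope group_scope.

(* Groups are possibly infinite [groupType]s and subsets of a group are
   classical sets. A permutation group on X is a group G with a faithful left
   action [act : G -> X -> X], where [act g x] stands for g(x). *)

Section Groups.
Variable G : groupType.
Implicit Types (g i : G) (A B N : set G).

Definition infinite_order g : Prop := forall n, (0 < n)%N -> g ^+ n <> 1.

Definition involution i : Prop := i <> 1 /\ i ^+ 2 = 1.

Definition subgroup A : Prop := group_closed (mem A).

Definition normal_subgroup N : Prop :=
  subgroup N /\ forall n g, N n -> N (n ^ g).

Definition abelian A : Prop := forall a b, A a -> A b -> commute a b.

Definition left_cosets B A : set (set G) :=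
  [set [set g * a | a in A] | g in B].

Definition virtually_abelian B : Prop :=
  exists A, [/\ subgroup A, A `<=` B, abelian A & finite_set (left_cosets B A)].

(* G is the internal semidirect product of N and B. *)
Definition semidirect_product N B : Prop :=
  [/\ normal_subgroup N, subgroup B, N `&` B = [set 1]
    & [set n * b | n in N & b in B] = [set: G]].

End Groups.

Section PermutationGroups.
Variables (G : groupType) (X : Type) (act : G -> X -> X).

Definition permutation_group : Prop :=
  [/\ forall x, act 1 x = x,
      forall g h x, act (g * h) x = act g (act h x)
    & forall g, (forall x, act g x = x) -> g = 1].

Definition sharply_2transitive : Prop :=
  (exists x y : X, x <> y) /\
  forall x y x' y', x <> y -> x' <> y' ->
    exists! g, act g x = x' /\ act g y = y'.

Definition point_stabilizer (x : X) : set G := [set g | act g x = x].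

Definition permutation_char0 : Prop :=
  (forall i : G, involution i -> exists x, act i x = x) /\
  (forall i j : G, involution i -> involution j -> i <> j ->
    infinite_order (i * j)).

Definition split_group : Prop :=
  forall x, exists N, semidirect_product N (point_stabilizer x).

End PermutationGroups.

(* Main.v *)
Require Import Defs.
From mathcomp Require Import all_boot.
From mathcomp Require Import boolp classical_sets cardinality.

(** In permutation characteristic 0 every point x is the fixed point of exactly
one involution s x, the point reflection at x, so that G acts on its involutions
by conjugation as it acts on X. Fix a point o with stabilizer B. The elements
t = s u * s o are the translations from o: one of them carries o to any given
point, because any two points have a unique midpoint. Hence G = T B and
T `&` B = 1 for the set T of these translations, and G splits over B as soon as
T is closed under products. When t * t' = t'' * d with translations t, t', t''
and d in B, the coefficient d measures the failure of t * t' to be a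
translation; geometrically it is the holonomy of the triangle with vertices o,
t o and t (t' o).

Let A be an abelian subgroup of finite index in B. Three facts give the result.

1. A coefficient lying in A is trivial ([coefficient_trivial]). If d <> 1 is
in A, map a point z to the midpoint of z and s o (d z); this midpoint u is the
unique one such that s u * s o * d fixes z. The map is injective, because
s u * s o * d fixes only one point, and it commutes with A, because A
centralizes d. As A has finitely many orbits on X minus o, all regular, the map
is surjective ([equivariant_surjective]). So t * d has a fixed point for every
translation t, whereas a nontrivial product of two involutions has none.

2. For translations a and b, some positive power of b commutes with a
([commute_power]). Write a * b ^+ k = t k * d k, with t k in T and d k in B. Two
of the infinitely many d k lie in the same right coset of A, and
d l * (d k)^-1 is again a coefficient, namely that of the triangle with vertices
o, t k o and t l o. By the first fact d k = d l, and this forces a ^+ 2 to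
commute with b ^+ (l - k). Every translation is the square of one.

3. A product of translations is a translation ([translation_mul]). Write
a * b = t * d. By the second fact a suitable power of b commutes with a, b
and t, hence with d. But a nontrivial translation moves o, so an element of B
commuting with it fixes two points and is trivial. *)

Set Implicit Arguments.
Unset Strict Implicit.
Unset Printing Implicit Defensive.

Local Open Scope classical_set_scope.
Local Open Scope group_scope.

(** * Recurrence in subgroups of finite index *)

Lemma finite_index_recurrence (G : groupType) (A B : set G) :
    subgroup A -> finite_set (left_cosets B A) ->
  forall f : nat -> G, (forall k, B (f k)) ->
  exists k l, (k < l)%N /\ A ((f k)^-1 * f l).
Proof.
move=> [A1 _] finA f Bf; apply: contrapT => norec.
pose h k := [set f k * a | a in A].
have hlt k l : (k < l)%N -> h k <> h l.
  move=> ltkl hkl; apply: norec; exists k, l; split=> //.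
  have : h l (f l) by exists 1; [exact: set_mem A1 | rewrite mulg1].
  by rewrite -hkl => -[a Aa <-]; rewrite mulKg.
have hinj k l : h k = h l -> k = l.
  by case: (ltngtP k l) => // /hlt nkl hkl; case: nkl.
apply: infinite_nat.
have -> : [set: nat] = h @^-1` left_cosets B A.
  by apply/seteqP; split=> // k _; exists (f k).
by apply: finite_preimage finA => k l _ _; apply: hinj.
Qed.

(** * Sharply 2-transitive actions and their involutions *)

Section SharplyTwoTransitive.
Variables (G : groupType) (X : Type) (act : G -> X -> X).
Implicit Types (g h i j a b d t r : G) (x m u v : X).
Hypotheses (hperm : permutation_group act) (h2 : sharply_2transitive act).
Hypothesis hchar : permutation_char0 act.

Let act1 x : act 1 x = x. Proof. by case: hperm. Qed.
Let actM g h x : act (g * h) x = act g (act h x). Proof. by case: hperm. Qed.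

Lemma actVK g x : act g^-1 (act g x) = x.
Proof. by rewrite -actM mulVg act1. Qed.

Lemma act_inj g x y : act g x = act g y -> x = y.
Proof. by move/(congr1 (act g^-1)); rewrite !actVK. Qed.

Lemma sharp_eq x y g h :
  x <> y -> act g x = act h x -> act g y = act h y -> g = h.
Proof.
move=> neq_xy ghx ghy.
have neq' : act h x <> act h y by move/act_inj.
case: (proj2 h2 _ _ _ _ neq_xy neq') => k [_ uniq_k].
by rewrite -(uniq_k g) // -(uniq_k h).
Qed.

Lemma sharp_fix x y g : x <> y -> act g x = x -> act g y = y -> g = 1.
Proof. by move=> neq_xy gx gy; apply: (sharp_eq neq_xy); rewrite act1. Qed.

Lemma ex_sharp x y x' y' : x <> y -> x' <> y' ->
  exists g, act g x = x' /\ act g y = y'.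
Proof. by move=> n n'; case: (proj2 h2 _ _ _ _ n n') => g [? _]; exists g. Qed.

Lemma involutionK i x : involution i -> act i (act i x) = x.
Proof. by case=> _ i2; rewrite -actM -expg2 i2 act1. Qed.

Lemma swap_involution g x y :
  x <> y -> act g x = y -> act g y = x -> involution g.
Proof.
move=> neq_xy gx gy; split=> [g1|]; first by apply: neq_xy; rewrite -gx g1 act1.
by apply: (sharp_fix neq_xy); rewrite expg2 actM ?gx ?gy.
Qed.

Lemma ex_swap x y : x <> y -> exists k, involution k /\ act k x = y.
Proof.
move=> neq_xy; have [k [kx ky]] := ex_sharp neq_xy (not_eq_sym neq_xy).
by exists k; split=> //; apply: swap_involution kx ky.
Qed.

Lemma swap_unique i j x :
  involution i -> involution j -> act i x <> x -> act i x = act j x -> i = j.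
Proof.
move=> ii ij mv eq_x; apply: (sharp_eq mv) => //.
by rewrite involutionK // eq_x involutionK.
Qed.

Lemma involution_fix_inj i x y :
  involution i -> act i x = x -> act i y = y -> x = y.
Proof.
move=> [i1 _] ix iy; apply: contrapT => neq.
by apply: i1; apply: sharp_fix ix iy.
Qed.

Lemma involutionJ i g : involution i -> involution (g * i * g^-1).
Proof.
move=> [i1 i2]; split.
  move=> e; apply: i1; apply: (mulgI g); apply: (mulIg g^-1).
  by rewrite /= e mulg1 mulgV.
by rewrite expg2 !mulgA mulgVK -(mulgA g) -expg2 i2 mulg1 mulgV.
Qed.

Lemma reflection_exists x : exists i, involution i /\ act i x = x.
Proof.
have [[a [b neq_ab]] _] := h2.
have [k [ik _]] := ex_swap neq_ab; have [m km] := proj1 hchar _ ik.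
have [<-|neq_mx] := EM (m = x); first by exists k.
have [g [gm _]] := ex_sharp neq_mx (not_eq_sym neq_mx).
exists (g * k * g^-1); split; first exact: involutionJ.
by rewrite !actM -gm actVK km.
Qed.

(** The b in the stabilizer of a further point x that carries i x to j x
conjugates i to j, because an involution is determined by one pair of points
that it swaps. Then b also fixes the common fixed point m of i and j, so that
b = 1. *)
Lemma reflection_unique i j m :
  involution i -> involution j -> act i m = m -> act j m = m -> i = j.
Proof.
move=> ii ij im jm.
have [x neq_mx] : exists x, m <> x.
  have [[a [b neq_ab]] _] := h2; have [ma|] := EM (m = a); last by exists a.
  by exists b; rewrite ma.
have mvi : act i x <> x.
  by move=> ix; apply: neq_mx; apply: involution_fix_inj im ix.
have mvj : act j x <> x.
  by move=> jx; apply: neq_mx; apply: involution_fix_inj jm jx.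
have [b [bx by_]] := ex_sharp (not_eq_sym mvi) (not_eq_sym mvj).
have bij : b * i * b^-1 = j.
  apply: (@swap_unique _ _ x) => //; first exact: involutionJ.
    by rewrite !actM -{1}bx actVK by_.
  by rewrite !actM -{1}bx actVK by_.
have bm : act b m = m.
  by apply: (involution_fix_inj ij) => //; rewrite -bij !actM actVK im.
have b1 : b = 1 by apply: sharp_fix neq_mx bm bx.
by rewrite -bij b1 mul1g invg1 mulg1.
Qed.

(** * Point reflections and midpoints *)

Variable s : X -> G.
Hypothesis s_inv : forall x, involution (s x).
Hypothesis s_fix : forall x, act (s x) x = x.

Lemma refl_mul x : s x * s x = 1.
Proof. by have [_] := s_inv x; rewrite expg2. Qed.

Lemma reflV x : (s x)^-1 = s x.
Proof. by apply: mulg1_eq; exact: refl_mul. Qed.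

Lemma refl_mulK x g : g * s x * s x = g.
Proof. by rewrite -mulgA refl_mul mulg1. Qed.

Lemma refl_fixE x y : act (s x) y = y -> x = y.
Proof. by move=> h; apply: (involution_fix_inj (s_inv x)). Qed.

Lemma reflP i x : involution i -> act i x = x -> i = s x.
Proof. by move=> ii ix; apply: (reflection_unique ii _ ix). Qed.

Lemma involution_refl i : involution i -> exists x, i = s x.
Proof.
by move=> ii; have [x ix] := proj1 hchar _ ii; exists x; apply: reflP.
Qed.

Lemma reflJ g x : g * s x * g^-1 = s (act g x).
Proof. by apply: reflP; [exact: involutionJ | rewrite !actM actVK s_fix]. Qed.

Lemma midpoint x y : exists m, act (s m) x = y.
Proof.
have [<-|neq_xy] := EM (x = y); first by exists x.
by have [k [/involution_refl[m ->] kx]] := ex_swap neq_xy; exists m.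
Qed.

Lemma midpoint_unique m m' x : act (s m) x = act (s m') x -> m = m'.
Proof.
move=> eq_x; have [mx|mv] := EM (act (s m) x = x).
  by rewrite (refl_fixE mx); apply/esym/refl_fixE; rewrite -eq_x.
apply: (@involution_fix_inj (s m)) => //.
by rewrite (swap_unique (s_inv m) (s_inv m') mv eq_x).
Qed.

(** * Translations from a base point *)

Variable o : X.
Notation B := (point_stabilizer act o).

Definition translation : set G := [set g | exists u, g = s u * s o].
Notation T := translation.

Lemma translation1 : T 1.
Proof. by exists o; rewrite refl_mul. Qed.

(** An anti-automorphism of G that fixes every translation: applying it to an
identity between translations reverses the order of the factors. *)
Definition reversal g := s o * g^-1 * s o.

Lemma reversalM g h : reversal (g * h) = reversal h * reversal g.
Proof. by rewrite /reversal invgM !mulgA refl_mulK. Qed.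

Lemma reversal_translation t : T t -> reversal t = t.
Proof.
by case=> u ->; rewrite /reversal invgM !reflV mulgA refl_mul mul1g.
Qed.

Lemma reversalX t n : reversal t = t -> reversal (t ^+ n) = t ^+ n.
Proof.
move=> rt; elim: n => [|n IHn].
  by rewrite expg0 /reversal invg1 mulg1 refl_mul.
by rewrite {1}expgS reversalM IHn rt -expgSr.
Qed.

(** The condition says that t * s o squares to 1, so t * s o is 1 or a point
reflection; the value 1 is the case t = s o. *)
Lemma translation_reversal t : reversal t = t -> t <> s o -> T t.
Proof.
move=> rev_t neq; have [e|nt] := EM (t * s o = 1).
  by case: neq; rewrite -[t](refl_mulK o) e mul1g.
have : involution (t * s o).
  split=> //; rewrite expg2 -{1}rev_t /reversal refl_mulK.
  by rewrite -!mulgA mulKg refl_mul.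
by case/involution_refl=> u e; exists u => //; rewrite -e refl_mulK.
Qed.

Lemma translation_stab t : T t -> act t o = o -> t = 1.
Proof.
by case=> u ->; rewrite actM s_fix => /refl_fixE ->; exact: refl_mul.
Qed.

Lemma translation_mul_stab1 t d : T t -> B d -> t * d = 1 -> d = 1.
Proof.
move=> Tt dB td1; have := actM t d o.
rewrite td1 act1 dB => /esym/translation_stab t1.
by rewrite -td1 t1 ?mul1g.
Qed.

Lemma translation_infinite_order t : T t -> t <> 1 -> infinite_order t.
Proof.
case=> u -> nt; apply: (proj2 hchar) => // e; apply: nt.
by rewrite e refl_mul.
Qed.

Lemma translationX t n : T t -> T (t ^+ n).
Proof.
move=> Tt.
apply: translation_reversal; first exact/reversalX/reversal_translation.
move=> e.
have [t1|nt] := EM (t = 1).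
  by case: (s_inv o); rewrite -e t1 expg1n.
case: n e => [|n] e; first by case: (s_inv o); rewrite -e expg0.
apply: (@translation_infinite_order t Tt nt (n.+1 * 2)%N) => //.
by rewrite expgnA e; case: (s_inv o).
Qed.

Lemma translationJ d t : B d -> T t -> T (d * t * d^-1).
Proof.
move=> dB [u ->]; exists (act d u) => //.
by rewrite -{2}dB -!reflJ !mulgA mulgVK.
Qed.

Lemma translation_decomp g : exists t d, [/\ T t, B d & g = t * d].
Proof.
have [m mo] := midpoint o (act g o).
exists (s m * s o), ((s m * s o)^-1 * g); split; first by exists m.
  by rewrite /point_stabilizer /= invgM !reflV !actM -mo involutionK.
by rewrite mulVKg.
Qed.

Lemma translation_sqrt t : T t -> exists r, T r /\ t = r ^+ 2.
Proof.
case=> u ->; have [m mo] := midpoint o u.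
exists (s m * s o); split; first by exists m.
by rewrite expg2 -mo -reflJ reflV !mulgA.
Qed.

Lemma translation_mul2 t t' : T t -> T t' -> exists u v, t * t' = s u * s v.
Proof.
move=> [u ->] [v ->]; exists u, (act (s o) v).
by rewrite -reflJ reflV !mulgA.
Qed.

Lemma stab_commute_translation d t :
  B d -> T t -> t <> 1 -> commute d t -> d = 1.
Proof.
move=> dB Tt nt cdt; have neq : o <> act t o.
  by move=> e; apply: nt; apply: translation_stab.
by apply: (sharp_fix neq) => //; rewrite -actM cdt actM dB.
Qed.

(** * Coefficients in an abelian subgroup of finite index *)

Variable A : set G.
Hypotheses (subgA : subgroup A) (sAB : A `<=` B) (abA : abelian A).
Hypothesis finA : finite_set (left_cosets B A).

(** B is regular on X minus o, so A has finitely many orbits there. The forward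
orbit of u under phi meets one of them twice, and injectivity pulls the
coincidence back to u itself. *)
Lemma equivariant_surjective (phi : X -> X) :
    (forall x y, phi x = phi y -> x = y) -> phi o = o ->
    (forall a x, A a -> phi (act a x) = act a (phi x)) ->
  forall u, exists z, phi z = u.
Proof.
move=> phi_inj phi_o phiA u.
have [->|neq_u] := EM (u = o); first by exists o.
have iter_inj k x y : iter k phi x = iter k phi y -> x = y.
  by elim: k => //= k IHk /phi_inj.
have iter_o k : iter k phi o = o by elim: k => //= k ->.
have iterA k a x : A a -> iter k phi (act a x) = act a (iter k phi x).
  by move=> Aa; elim: k => //= k ->; rewrite phiA.
have /choice[b bP] k : exists b, act b o = o /\ act b u = iter k phi u.
  apply: ex_sharp (not_eq_sym neq_u) _ => e; apply: neq_u.
  by apply: (@iter_inj k); rewrite iter_o.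
have [k|k [l [ltkl Aa]]] :=
    @finite_index_recurrence _ A B subgA finA (fun k => (b k)^-1).
  by rewrite /point_stabilizer /= -{1}(proj1 (bP k)) actVK.
move: Aa; set a := (_ * _) => Aa.
have {}Aa : A a by [].
have ab : act a (iter l phi u) = iter k phi u.
  by rewrite /a actM invgK -(proj2 (bP l)) actVK (proj2 (bP k)).
have au : act a (iter (l - k) phi u) = u.
  by apply: (@iter_inj k); rewrite iterA // -iterD subnKC ?ab // ltnW.
exists (act a (iter (l - k).-1 phi u)).
by rewrite phiA // -iterS prednK ?subn_gt0.
Qed.

(** A nontrivial d in A would make t * d have a fixed point, although it is a
product of two involutions. *)
Lemma coefficient_trivial d t t1 t2 :
  A d -> T t -> T t1 -> T t2 -> t * d = t1 * t2 -> d = 1.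
Proof.
move=> Ad Tt T1 T2 e; apply: contrapT => nd.
have dB : act d o = o by exact: (sAB Ad).
have [u tu] := Tt.
have /choice[phi phiP] z : exists m, act (s m) (act (s o) (act d z)) = z.
  exact: midpoint.
have phiE m z : act (s m * s o * d) z = z -> phi z = m.
  by move=> mz; apply: (@midpoint_unique _ _ (act (s o) (act d z)));
     rewrite phiP -{1}mz !actM.
have phiE' z : act (s (phi z) * s o * d) z = z by rewrite !actM phiP.
have fix_eq x y m :
    act (s m * s o * d) x = x -> act (s m * s o * d) y = y -> x = y.
  move=> mx my; apply: contrapT => neq; apply: nd.
  have md1 := sharp_fix neq mx my.
  by apply: translation_mul_stab1 dB md1; exists m.
have phi_inj x y : phi x = phi y -> x = y.
  by move=> exy; apply: (@fix_eq _ _ (phi x)); rewrite ?phiE' // exy phiE'.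
have phi_o : phi o = o by apply: phiE; rewrite refl_mul mul1g.
have phiA a x : A a -> phi (act a x) = act a (phi x).
  move=> Aa; apply: phiE.
  have aB : act a o = o by exact: (sAB Aa).
  have -> : s (act a (phi x)) * s o * d = a * (s (phi x) * s o * d) * a^-1.
    have so : s o = a * s o * a^-1 by rewrite reflJ aB.
    rewrite -reflJ {1}so !mulgA mulgVK -!mulgA; do 3 congr (_ * _).
    by apply/esym/commuteV/abA.
  by rewrite !actM actVK phiP.
have [z phiz] := equivariant_surjective phi_inj phi_o phiA u.
have tdz : act (t * d) z = z by rewrite tu -phiz phiE'.
have [v [w vw]] := translation_mul2 T1 T2.
have evw : w = v.
  apply: (@midpoint_unique _ _ z).
  by rewrite -{2}tdz e vw actM involutionK.
by apply: nd; apply: translation_mul_stab1 Tt dB _; rewrite e vw evw refl_mul.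
Qed.

(** In the factorization a * b ^+ k = t k * d k, equal coefficients at k and l
make conjugation by a and by d k agree on b ^+ (l - k). The common conjugate y
is a translation, so reversal fixes it and y is also the conjugate by a^-1. *)
Lemma sqr_commute_power a b : T a -> T b ->
  exists n, (0 < n)%N /\ commute (a ^+ 2) (b ^+ n).
Proof.
move=> Ta Tb.
have /choice[f fP] k : exists td : G * G,
    [/\ T td.1, B td.2 & a * b ^+ k = td.1 * td.2].
  by have [t [d tdP]] := translation_decomp (a * b ^+ k); exists (t, d).
pose t k := (f k).1; pose d k := (f k).2.
have Tt k : T (t k) by case: (fP k).
have Bd k : B (d k) by case: (fP k).
have abk k : a * b ^+ k = t k * d k by case: (fP k).
(* Inverses turn the left cosets of A into right cosets. *)
have [k|k [l [ltkl]]] :=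
    @finite_index_recurrence _ A B subgA finA (fun k => (d k)^-1).
  by rewrite /point_stabilizer /= -{1}(Bd k) actVK.
have [A1 AV] := subgA.
move=> /mem_set Akl.
have {Akl} /set_mem Alk : d l * (d k)^-1 \in A.
  by have := AV _ _ A1 Akl; rewrite mul1g invgM !invgK.
exists (l - k)%N; split; first by rewrite subn_gt0.
set n := (l - k)%N; pose y := d k * b ^+ n * (d k)^-1.
have Ty : T y by apply: translationJ => //; apply: translationX.
(* d l * (d k)^-1 is the coefficient of the product of translations t k * y. *)
have ekl : t l * (d l * (d k)^-1) = t k * y.
  by rewrite /y !mulgA -!abk -(mulgA a (b ^+ k)) -expgnDr subnKC // ltnW.
have dkl : d l = d k.
  by apply: divg1_eq; apply: coefficient_trivial ekl.
have {}ekl : t l = t k * y by rewrite -ekl dkl mulgV mulg1.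
have revE := reversal_translation.
have cty : t k * y = y * t k.
  by rewrite -ekl -(revE (t l)) // ekl reversalM !revE.
have ab_ya : a * b ^+ n = y * a.
  apply: (mulIg (b ^+ k)) => /=.
  rewrite -[RHS]mulgA (abk k) mulgA -cty -[LHS]mulgA -expgnDr addnC expgnDr.
  by rewrite mulgA (abk k) /y !mulgA mulgVK.
have ba_ay : b ^+ n * a = a * y.
  have := congr1 reversal ab_ya.
  by rewrite (reversalM a) (reversalM y) !revE //; apply: translationX.
by rewrite /commute expg2 -mulgA ab_ya mulgA -ba_ay -mulgA.
Qed.

(** * The translations form a normal complement *)

Lemma commute_power a b : T a -> T b ->
  exists n, (0 < n)%N /\ commute a (b ^+ n).
Proof.
by move=> /translation_sqrt[r [Tr ->]] Tb; apply: sqr_commute_power.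
Qed.

(** Both a and the translation part t of a * b commute with a common power of b,
by taking a power twice; so does b, and therefore the coefficient d. *)
Lemma translation_mul a b : T a -> T b -> T (a * b).
Proof.
move=> Ta Tb; have [->|nb] := EM (b = 1); first by rewrite mulg1.
have [n [n0 can]] := commute_power Ta Tb.
have [t [d [Tt Bd abE]]] := translation_decomp (a * b).
have Tw := translationX n Tb.
have [l [l0 ctl]] := commute_power Tt Tw.
have cabw : commute (a * b) (b ^+ n ^+ l).
  apply: commuteX; apply: commute_sym.
  by apply: commuteM; apply: commute_sym => //; apply: commuteX.
suff d1 : d = 1 by rewrite abE d1 mulg1.
apply: (@stab_commute_translation d (b ^+ n ^+ l)) => //.
- exact: translationX.
- rewrite -expgnA; apply: (translation_infinite_order Tb nb).
  by rewrite muln_gt0 n0.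
have -> : d = t^-1 * (a * b) by rewrite abE mulKg.
apply: commute_sym; apply: commuteM; last exact: commute_sym.
by apply: commuteV; apply: commute_sym.
Qed.

Lemma translationV t : T t -> T t^-1.
Proof.
move=> Tt; have [u ->] := Tt; exists (act (s o) u).
by rewrite -reflJ reflV refl_mulK invgM !reflV.
Qed.

Lemma refl_mul_translation u v : T (s u * s v).
Proof.
have -> : s u * s v = (s u * s o) * (s v * s o)^-1.
  by rewrite invgM !reflV !mulgA refl_mulK.
by apply: translation_mul; [|apply: translationV]; [exists u | exists v].
Qed.

(** Normality holds because T is the set of all products of two point
reflections, a description that does not mention o. *)
Lemma semidirect_translation : semidirect_product T B.
Proof.
split.
- split=> [|t g [u ->]].
    split=> [|a b /set_mem Ta /set_mem Tb]; first exact/mem_set/translation1.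
    by apply/mem_set/translation_mul => //; apply: translationV.
  rewrite conjMg; have sJ x : s x ^ g = s (act g^-1 x).
    by rewrite -reflJ invgK conjgE mulgA.
  by rewrite !sJ; apply: refl_mul_translation.
- split=> [|a b /set_mem Ba /set_mem Bb]; first exact/mem_set/act1.
  by apply: mem_set; rewrite /point_stabilizer /= actM -{1}Bb actVK Ba.
- apply/seteqP; split=> [t [Tt Bt]|_ ->]; first exact: translation_stab Tt Bt.
  by split; [exact: translation1 | exact: act1].
- apply/seteqP; split=> // g _; have [t [d [Tt Bd ->]]] := translation_decomp g.
  by exists t => //; exists d.
Qed.

End SharplyTwoTransitive.

Theorem corollary2p6 (G : groupType) (X : Type) (act : G -> X -> X)
  (hperm : permutation_group act)
  (h2 : sharply_2transitive act)
  (hchar : permutation_char0 act)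
  (hva : forall x : X, virtually_abelian (point_stabilizer act x)) :
  split_group act.
Proof.
move=> o; have /choice[s sP] := reflection_exists hperm h2 hchar.
have [A [subgA sAB abA finA]] := hva o.
exists (translation s o).
by apply: (semidirect_translation hperm h2 hchar _ _ subgA) => // x;
   case: (sP x).
Qed.
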